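(* Let $\alpha>\beta$ be positive integers, let $k\geq 2$, and let $n_1,\dots,n_k$ be integers with $n_1,n_2\geq 2\alpha+1$ and $n_3,\dots,n_k\geq \alpha+\beta-1$. If an $(\alpha,\beta)$-tour on the $n_1\times n_2$ chessboard exists, then an $(\alpha,\beta)$-tour on the $n_1\times n_2\times\cdots\times n_k$ chessboard exists.
   Context: The $n_1\times\cdots\times n_d$ chessboard is $\{1,\dots,n_1\}\times\cdots\times\{1,\dots,n_d\}\subset\mathbb{Z}^d$. An $(\alpha,\beta)$-move is a vector in $\mathbb{Z}^d$ with exactly $d-2$ coordinates equal to $0$, exactly one coordinate in $\{\pm\alpha\}$ and exactly one coordinate in $\{\pm\beta\}$. Two cells are adjacent iff their difference is an $(\alpha,\beta)$-move. An $(\alpha,\beta)$-tour is a Hamiltonian cycle in this graph. *)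

(* Defs.v *)
From mathcomp Require Import all_boot all_order all_algebra.
Set Implicit Arguments. Unset Strict Implicit. Unset Printing Implicit Defensive.
Import Order.TTheory GRing.Theory Num.Theory.
Local Open Scope ring_scope.

Definition cell := seq int.

Definition on_board (dims : seq nat) (x : cell) : bool :=
  (size x == size dims) &&
  [forall i : 'I_(size dims), (1 <= nth 0 x i) && (nth 0 x i <= (nth 0%N dims i)%:Z)].

Definition is_move (a b : nat) (v : cell) : bool :=
  [exists i : 'I_(size v), [exists j : 'I_(size v),
     [&& i != j, `|nth 0 v i| == a%:Z, `|nth 0 v j| == b%:Z &
         [forall l : 'I_(size v), (l != i) ==> (l != j) ==> (nth 0 v l == 0)]]]].

Definition vsub (x y : cell) : cell := [seq p.1 - p.2 | p <- zip x y].

Definition adj (a b : nat) (dims : seq nat) : rel cell :=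
  fun x y => [&& on_board dims x, on_board dims y & is_move a b (vsub y x)].

Definition is_tour (a b : nat) (dims : seq nat) (c : seq cell) : Prop :=
  [/\ uniq c, (3 <= size c)%N, (forall x, x \in c = on_board dims x)
    & cycle (adj a b dims) c].

Definition tour_exists (a b : nat) (dims : seq nat) : Prop :=
  exists c : seq cell, is_tour a b dims c.

(* Main.v *)
Require Import Defs.
From mathcomp Require Import all_boot all_order all_algebra.
From mathcomp Require Import zify.

(* Dimensions n_3, ..., n_k are added one at a time: the new board is a stack of
   m layers, each carrying a copy of the tour already built, and these copies are
   spliced together. In a two-dimensional tour the corner (1,1) has only two
   possible neighbours, so both of its edges are forced; and every possible
   neighbour of (1+alpha,1), apart from one exception, differs by +-alpha along
   the first axis from an end of a forced edge. As (1+alpha,1) has two edges, one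
   of them can be used to splice layers z and z-beta; layers z and z+alpha are
   spliced similarly, with (1+beta,1). Starting from layer alpha the steps
   +alpha and -beta reach every layer: they traverse the nonzero residues
   j*alpha mod alpha+beta (alpha and beta are coprime because a tour exists), and
   the layers above follow by +alpha. A layer is the source of at most one step of
   each kind, so it suffices to use a different corner, (1,1) or (1,n_2), for each
   kind. All splicing happens in one fibre [w] of the first two coordinates. The
   first stack leaves the two opposite corners untouched in every fibre; after a
   half turn of the board, each later stack spends one intact fibre and leaves all
   the copies of another one. *)

Set Implicit Arguments. Unset Strict Implicit. Unset Printing Implicit Defensive.
Import Order.TTheory GRing.Theory Num.Theory.
Local Open Scope ring_scope.

(** * Edges of a cyclic sequence, and splicing two cycles *)

(** The membership tests matter because [next] fixes every point off the cycle. *)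
Definition cedge (T : eqType) (c : seq T) (x y : T) : bool :=
  [&& x \in c, y \in c & (next c x == y) || (next c y == x)].

Section CyclicEdges.
Variable T : eqType.
Implicit Types (c s : seq T) (e : rel T).

Lemma cedgeC c x y : cedge c x y = cedge c y x.
Proof. by rewrite /cedge andbCA orbC. Qed.

Lemma cedge_rot c n : uniq c -> cedge (rot n c) =2 cedge c.
Proof. by move=> Uc x y; rewrite /cedge !mem_rot !next_rot. Qed.

Lemma cedge_rev c : uniq c -> cedge (rev c) =2 cedge c.
Proof.
move=> Uc x y; rewrite /cedge !mem_rev !next_rev //.
have E u v : u \in c -> v \in c -> (prev c u == v) = (next c v == u).
  by move=> _ _; apply/eqP/eqP => <-; rewrite ?next_prev ?prev_next.
have [cx|] := boolP (x \in c); have [cy|] := boolP (y \in c) => //=.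
by rewrite !E // orbC.
Qed.

Lemma cedge_map (T' : eqType) (f : T -> T') c x y :
  injective f -> uniq c -> cedge (map f c) (f x) (f y) = cedge c x y.
Proof.
by move=> inj_f Uc; rewrite /cedge !mem_map // !next_map // !(inj_eq inj_f).
Qed.

(** Lengthening the list breaks only the closing edge of [p :: s1], and that edge contains [p]. *)
Lemma cedge_catl s1 s2 p x y : uniq (p :: s1 ++ s2) ->
  cedge (p :: s1) x y -> x != p -> y != p -> cedge (p :: s1 ++ s2) x y.
Proof.
have nextE s u : u \in p :: s -> next (p :: s) u = nth p s (index u (p :: s)).
  by rewrite next_nth => ->.
have next_catl u v : u \in p :: s1 -> v != p ->
    next (p :: s1) u == v -> next (p :: s1 ++ s2) u == v.
  move=> pu pv; rewrite !nextE //; last by rewrite -cat_cons mem_cat pu.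
  rewrite -cat_cons index_cat pu nth_cat.
  by case: ltnP => // le_s1; rewrite nth_default // eq_sym (negPf pv).
move=> Uc /and3P[px py /orP nxt] xp yp.
rewrite /cedge -!cat_cons !mem_cat px py; apply/orP.
by case: nxt => /next_catl nxt; [left|right]; apply: nxt.
Qed.

(** A rotation, after a reversal if need be, turns the chosen edge into the closing edge of the
    list. *)
Lemma cycle_edge_normal e c p q : symmetric e -> uniq c -> cycle e c ->
  cedge c p q ->
  exists s, [/\ perm_eq (p :: s) c, last p s = q, cycle e (p :: s)
              & cedge (p :: s) =2 cedge c].
Proof.
move=> sym_e; wlog nqp : c / next c q = p => [hw Uc ec cpq|].
  have /and3P[pc qc /orP[/eqP nxt|/eqP nxt]] := cpq; last exact: hw.
  have ec' : cycle e (rev c).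
    by rewrite rev_cycle; rewrite (eq_cycle (e' := e)) // => x y; rewrite sym_e.
  have Uc' : uniq (rev c) by rewrite rev_uniq.
  have [||s [ps ls es Es]] := hw (rev c) _ Uc' ec'.
  - by rewrite next_rev // -nxt prev_next.
  - by rewrite cedge_rev.
  exists s; split=> //; first by rewrite (perm_trans ps) // perm_rev.
  by move=> x y; rewrite Es cedge_rev.
move=> Uc ec /and3P[pc qc _].
have [i s Ec] := rot_to pc.
exists s; split.
- by rewrite -Ec perm_rot.
- have <- : prev (rot i c) p = q by rewrite prev_rot // -nqp prev_next.
  rewrite Ec; have: uniq (p :: s) by rewrite -Ec rot_uniq.
  rewrite prev_nth mem_head /= => /andP[ps _].
  by rewrite (memNindex ps) nth_last.
- by rewrite -Ec rot_cycle.
- by move=> x y; rewrite -Ec cedge_rot.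
Qed.

(** Delete the edges [p q] and [p' q'], then join [p] to [p'] and [q] to [q']. A lost edge contains
    [p] or [p'], hence the form of the last two clauses. *)
Lemma merge_cycles e c1 c2 p q p' q' : symmetric e ->
  uniq (c1 ++ c2) -> cycle e c1 -> cycle e c2 ->
  cedge c1 p q -> cedge c2 p' q' -> e p p' -> e q q' ->
  exists c, [/\ perm_eq c (c1 ++ c2), cycle e c,
    forall x y, cedge c1 x y -> x != p -> y != p -> cedge c x y
  & forall x y, cedge c2 x y -> x != p' -> y != p' -> cedge c x y].
Proof.
move=> sym_e Uc ec1 ec2 c1pq; rewrite cedgeC => c2qp epp eqq.
move: (Uc); rewrite cat_uniq => /and3P[U1 _ U2].
have [s1 [perm1 last1 es1 E1]] := cycle_edge_normal sym_e U1 ec1 c1pq.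
have [s2 [perm2 last2 es2 E2]] := cycle_edge_normal sym_e U2 ec2 c2qp.
have perm12 : perm_eq (p :: s1 ++ q' :: s2) (c1 ++ c2).
  by rewrite -cat_cons perm_cat.
have U12 : uniq (p :: s1 ++ q' :: s2) by rewrite (perm_uniq perm12).
exists (p :: s1 ++ q' :: s2); split=> //.
- move: es1 es2; rewrite /= !rcons_path last_cat cat_path /= last1 last2.
  by move=> /andP[-> _] /andP[-> _]; rewrite eqq sym_e epp.
- by move=> x y; rewrite -E1; exact: cedge_catl.
- have Us2 : uniq (q' :: s2) by rewrite (perm_uniq perm2).
  (* Read backwards, the merged list begins with [p'], so [cedge_catl] applies to the second cycle
     too. *)
  move=> x y; rewrite -E2 -(cedge_rev Us2) -(cedge_rev U12) -cat_cons rev_cat.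
  rewrite lastI last2 rev_rcons cat_cons; apply: cedge_catl.
  by rewrite -cat_cons -rev_rcons -last2 -lastI -rev_cat cat_cons rev_uniq.
Qed.

Lemma cycle_two_neighbours e c x : symmetric e -> uniq c -> (3 <= size c)%N ->
  cycle e c -> x \in c ->
  exists y z, [/\ y != z, cedge c x y, cedge c x z, e x y & e x z].
Proof.
move=> sym_e Uc c3 ec cx; exists (next c x), (prev c x).
split.
- have [i s Ec] := rot_to cx.
  rewrite -(next_rot i) // -(prev_rot i) //.
  have: uniq (rot i c) by rewrite rot_uniq.
  have: (2 < size (rot i c))%N by rewrite size_rot.
  rewrite {}Ec next_nth prev_nth mem_head /= eqxx.
  case: s => [|y [|z s]] // _ /andP[xs /andP[ys _]].
  rewrite (memNindex xs) nth_last /=.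
  by apply: contraNneq ys => ->; rewrite mem_last.
- by rewrite /cedge cx mem_next cx eqxx.
- by rewrite /cedge cx mem_prev cx next_prev // eqxx orbT.
- exact: next_cycle.
- by rewrite sym_e; apply: prev_cycle.
Qed.

End CyclicEdges.

(** * Boards and moves: inserting a coordinate, and the half turn of the first two axes *)

Lemma on_board_cons d ds t x :
  on_board (d :: ds) (t :: x) = (1 <= t <= d%:Z) && on_board ds x.
Proof.
rewrite /on_board /= eqSS andbCA; congr (_ && _).
apply/forallP/andP => [H|[t1 /forallP H] [[|i] lti]] //=.
  split; first by have := H ord0.
  by apply/forallP => i; have := H (lift ord0 i).
by have := H (Ordinal (lti : (i < size ds)%N)).
Qed.

Lemma on_board_nil : on_board [::] [::].
Proof. by rewrite /on_board eqxx; apply/forallP => -[]. Qed.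

Lemma size_on_board dims x : on_board dims x -> size x = size dims.
Proof. by case/andP => /eqP. Qed.

Lemma on_board2P n1 n2 ns h : on_board (n1 :: n2 :: ns) h ->
  exists x y w, [/\ h = [:: x, y & w], 1 <= x <= n1%:Z, 1 <= y <= n2%:Z
                  & on_board ns w].
Proof.
case: h => [|x [|y w]]; try by move/size_on_board.
by rewrite !on_board_cons => /and3P[? ? ?]; exists x, y, w.
Qed.

Definition move_at (a b : nat) (x y : cell) (i j : nat) : Prop :=
  [/\ i != j, `|nth 0 y i - nth 0 x i| = a%:Z, `|nth 0 y j - nth 0 x j| = b%:Z
    & forall l, l != i -> l != j -> nth 0 y l = nth 0 x l].

Lemma nth_vsub x y l : size x = size y ->
  nth 0 (vsub x y) l = nth 0 x l - nth 0 y l.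
Proof.
move=> sz; have [lt|ge] := ltnP l (size y).
  by rewrite (nth_map (0, 0)) ?size_zip ?sz ?minnn // nth_zip.
by rewrite !nth_default ?subr0 // ?size_map ?size_zip ?sz ?minnn.
Qed.

Lemma adjP a b dims x y :
  reflect [/\ on_board dims x, on_board dims y
    & exists i j, [/\ (i < size dims)%N, (j < size dims)%N & move_at a b x y i j]]
  (adj a b dims x y).
Proof.
have [bx|nbx] := boolP (on_board dims x); last first.
  by rewrite /adj (negPf nbx); constructor => -[].
have [bdy|nby] := boolP (on_board dims y); last first.
  by rewrite /adj (negPf nby) andbF; constructor => -[].
have sx := size_on_board bx; have sy := size_on_board bdy.
have sxy : size y = size x by rewrite sx sy.
have sv : size (vsub y x) = size dims by rewrite size_map size_zip sx sy minnn.
rewrite /adj bx bdy /=; apply: (iffP existsP).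
  case=> i /existsP[j /and4P[ij /eqP vi /eqP vj /forallP vl]].
  split=> //; exists i, j; split; rewrite -?sv //.
  split=> //; rewrite -?nth_vsub // => l li lj.
  have [ltl|gel] := ltnP l (size dims); last first.
    by rewrite !nth_default ?sx ?sy.
  have ltl' : (l < size (vsub y x))%N by rewrite sv.
  have := vl (Ordinal ltl'); rewrite -!val_eqE /= li lj /= => /eqP.
  by rewrite nth_vsub // => /eqP; rewrite subr_eq0 => /eqP.
case=> _ _ [i [j []]]; rewrite -sv => lti ltj [ij vi vj vl].
exists (Ordinal lti); apply/existsP; exists (Ordinal ltj).
rewrite !nth_vsub //= vi vj -val_eqE ij !eqxx /=.
apply/forallP => l; apply/implyP => li; apply/implyP => lj.
by rewrite nth_vsub // vl // subrr.
Qed.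

Lemma adj_sym a b dims : symmetric (adj a b dims).
Proof.
suff H x y : adj a b dims x y -> adj a b dims y x by move=> x y; apply/idP/idP; exact: H.
case/adjP => bx bdy [i [j [lti ltj [ij vi vj vl]]]].
apply/adjP; split=> //; exists i, j; split=> //; split=> //; rewrite 1?distrC //.
by move=> l li lj; rewrite vl.
Qed.

Lemma adj2P a b n1 n2 x y x' y' :
  adj a b [:: n1; n2] [:: x; y] [:: x'; y'] ->
  [/\ 1 <= x <= n1%:Z, 1 <= y <= n2%:Z, 1 <= x' <= n1%:Z, 1 <= y' <= n2%:Z
    & `|x' - x| = a%:Z /\ `|y' - y| = b%:Z \/ `|x' - x| = b%:Z /\ `|y' - y| = a%:Z].
Proof.
case/adjP; rewrite !on_board_cons => /and3P[-> -> _] /and3P[-> -> _].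
case=> i [j []] /= lti ltj [ij vi vj _]; split=> //.
case: i j lti ltj ij vi vj => [|[|i]] [|[|j]] //= _ _ _ -> ->; first by left.
by right.
Qed.

(** The new coordinate goes to the third place, so the first two axes keep their positions through
    all stacks. *)
Definition ins (z : nat) (h : cell) : cell := take 2 h ++ z%:Z :: drop 2 h.

Lemma ins_inj z z' h h' : (2 <= size h)%N -> (2 <= size h')%N ->
  ins z h = ins z' h' -> z = z' /\ h = h'.
Proof.
case: h h' => [|x [|y w]] // [|x' [|y' w']] // _ _.
by rewrite /ins /= !take0 !drop0 /= => -[-> -> -> ->].
Qed.

Lemma on_board_insP n1 n2 m ns x :
  reflect (exists z h, [/\ x = ins z h, (0 < z <= m)%N & on_board (n1 :: n2 :: ns) h])
          (on_board (n1 :: n2 :: m :: ns) x).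
Proof.
apply: (iffP idP) => [bx|[z [h [-> hz bh]]]].
  have [x1 [x2 [w [-> b1 b2]]]] := on_board2P bx.
  case: w => [/size_on_board //|z w]; rewrite on_board_cons => /andP[bz bw].
  exists `|z|%N, [:: x1, x2 & w]; rewrite /ins /= take0 drop0 !on_board_cons b1 b2.
  by split=> //; [congr [:: _, _, _ & _]; lia | lia].
have [x1 [x2 [w [-> b1 b2 bw]]]] := on_board2P bh.
rewrite /ins /= take0 drop0 /= !on_board_cons b1 b2 bw /= andbT; lia.
Qed.

Lemma adj_ins a b n1 n2 m ns z h k : (0 < z <= m)%N ->
  adj a b (n1 :: n2 :: ns) h k ->
  adj a b (n1 :: n2 :: m :: ns) (ins z h) (ins z k).
Proof.
move=> hz /adjP[bh bk [i [j [lti ltj [ij vi vj vl]]]]].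
have nth_ins c l : on_board (n1 :: n2 :: ns) c ->
    nth 0 (ins z c) l = if l == 2%N then z%:Z else nth 0 c (unbump 2 l).
  move=> /on_board2P[x1 [x2 [w [-> _ _ _]]]].
  by case: l => [|[|[|l]]] //=; rewrite /unbump /ins /= ?take0 ?drop0 ?subn1.
apply/adjP; split; try by apply/on_board_insP; exists z; eexists; split.
exists (bump 2 i), (bump 2 j); split.
- by move: lti; rewrite /= /bump; lia.
- by move: ltj; rewrite /= /bump; lia.
have nb l : (bump 2 l == 2%N) = false by rewrite eq_sym; apply/negbTE/neq_bump.
split.
- by rewrite (can_eq (bumpK 2)).
- by rewrite !nth_ins // nb bumpK.
- by rewrite !nth_ins // nb bumpK.
move=> l li lj; rewrite !nth_ins //; have [//|l2] := eqVneq l 2%N.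
by apply: vl; [apply: contraNneq li => <-|apply: contraNneq lj => <-];
  rewrite unbumpK // inE.
Qed.

Lemma adj_layers a b n1 n2 m ns x x' y z z' w (s t : nat) :
  on_board (n1 :: n2 :: m :: ns) [:: x, y, z & w] ->
  on_board (n1 :: n2 :: m :: ns) [:: x', y, z' & w] ->
  `|x' - x| = s%:Z -> `|z' - z| = t%:Z ->
  (s = a /\ t = b) \/ (s = b /\ t = a) ->
  adj a b (n1 :: n2 :: m :: ns) [:: x, y, z & w] [:: x', y, z' & w].
Proof.
move=> b1 b2 ds dt [] [es et]; subst; apply/adjP; split=> //.
  exists 0%N, 2%N; split=> //; split=> //.
  by case=> [|[|[|l]]].
exists 2%N, 0%N; split=> //; split=> //.
by case=> [|[|[|l]]].
Qed.

Definition flip (n1 n2 : nat) (h : cell) : cell :=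
  if h is x :: y :: w then n1%:Z + 1 - x :: n2%:Z + 1 - y :: w else h.

Lemma flipK n1 n2 : involutive (flip n1 n2).
Proof. by case=> [|x [|y w]] //=; congr [:: _, _ & _]; lia. Qed.

Lemma on_board_flip n1 n2 ns h :
  on_board (n1 :: n2 :: ns) (flip n1 n2 h) = on_board (n1 :: n2 :: ns) h.
Proof.
case: h => [|x [|y w]] //=; rewrite !on_board_cons; congr [&& _, _ & _]; lia.
Qed.

Lemma adj_flip a b n1 n2 ns h k : adj a b (n1 :: n2 :: ns) h k ->
  adj a b (n1 :: n2 :: ns) (flip n1 n2 h) (flip n1 n2 k).
Proof.
case/adjP => bh bk [i [j [lti ltj [ij vi vj vl]]]].
apply/adjP; rewrite !on_board_flip; split=> //; exists i, j; split=> //.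
have [x [y [w [Eh _ _ _]]]] := on_board2P bh.
have [x' [y' [w' [Ek _ _ _]]]] := on_board2P bk.
rewrite {}Eh {}Ek {lti ltj bh bk} in vi vj vl *.
split=> //.
- by rewrite -vi; case: i {ij vi vl} => [|[|i]] //=; lia.
- by rewrite -vj; case: j {ij vj vl} => [|[|j]] //=; lia.
by move=> l li lj; have := vl l li lj; case: l {li lj} => [|[|l]] //=; lia.
Qed.

Lemma tour_flip a b n1 n2 ns c : is_tour a b (n1 :: n2 :: ns) c ->
  is_tour a b (n1 :: n2 :: ns) (map (flip n1 n2) c).
Proof.
have inj_f := can_inj (flipK n1 n2).
case=> Uc c3 mem_c ec; split.
- by rewrite map_inj_uniq.
- by rewrite size_map.
- by move=> x; rewrite -(flipK n1 n2 x) mem_map // on_board_flip mem_c.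
- by rewrite cycle_map; apply: sub_cycle ec => h k; exact: adj_flip.
Qed.

(** * Consequences of being a tour: edges are moves, and [a] and [b] are coprime *)

Lemma tour_adj a b dims c x y : is_tour a b dims c -> cedge c x y -> adj a b dims x y.
Proof.
case=> Uc _ _ ec /and3P[cx cy /orP[]/eqP <-]; first exact: next_cycle.
by rewrite adj_sym; exact: next_cycle.
Qed.

Lemma path_invariant (T : eqType) (e : rel T) (P : T -> Prop) c x y :
  (forall u v, e u v -> P u -> P v) -> cycle e c -> x \in c -> y \in c -> P x -> P y.
Proof.
move=> stepP ec cx cy Px; have [i s Ec] := rot_to cx.
have : path e x (rcons s x) by have := rot_cycle i e c; rewrite Ec ec => cs; exact: cs.
have : y \in x :: s by rewrite -Ec mem_rot.
rewrite rcons_path => sy /andP[es _].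
elim: s x Px sy es {Ec cx} => [|z s IHs] x Px; rewrite in_cons => /predU1P[-> //|] // sy.
by move=> /andP[/stepP/(_ Px) Pz es]; exact: IHs Pz sy es.
Qed.

(** Every move changes the first coordinate by a multiple of the gcd, yet the tour visits both (1,1)
    and (2,1). *)
Lemma tour_coprime a b n1 n2 c : (2 <= n1)%N -> (1 <= n2)%N ->
  is_tour a b [:: n1; n2] c -> coprime a b.
Proof.
move=> n1_ge2 n2_ge1 [_ _ mem_c ec].
pose P (h : cell) := exists k : int, nth 0 h 0 = 1 + k * (gcdn a b)%:Z.
have c11 : [:: 1; 1] \in c by rewrite mem_c !on_board_cons on_board_nil; lia.
have c21 : [:: 2%:Z; 1] \in c by rewrite mem_c !on_board_cons on_board_nil; lia.
have stepP u v : adj a b [:: n1; n2] u v -> P u -> P v.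
  move=> uv [k Ek].
  have [bu bv _] := adjP _ _ _ _ _ uv.
  have [x [y [? [Eu _ _ /size_on_board/size0nil E0]]]] := on_board2P bu.
  have [x' [y' [? [Ev _ _ /size_on_board/size0nil E0']]]] := on_board2P bv.
  subst; have := adj2P uv.
  have /dvdnP[a' Ea] := dvdn_gcdl a b; have /dvdnP[b' Eb] := dvdn_gcdr a b.
  case=> _ _ _ _ move_uv; rewrite /P /= in Ek *.
  set g := gcdn a b in Ek Ea Eb *.
  have [d [Ed]] : exists d : nat, `|x' - x| = (d * g)%N%:Z.
    by case: move_uv => -[-> _]; [exists a'; rewrite -Ea|exists b'; rewrite -Eb].
  have [le|lt] := lerP x x'.
    by exists (k + d%:Z); nia.
  by exists (k - d%:Z); nia.
have P11 : P [:: 1; 1] by exists 0; rewrite mul0r addr0.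
have [k /= Ek] := path_invariant stepP ec c11 c21 P11.
rewrite /coprime -dvdn1; apply/dvdnP; exists `|k|%N.
have kg : k * (gcdn a b)%:Z = 1 by lia.
by have := congr1 absz kg; rewrite abszM.
Qed.

(** * Forced edges of a planar tour near two corners *)

Section Corners.
Variables a b n1 n2 : nat.
Hypotheses (b_gt0 : (0 < b)%N) (ltba : (b < a)%N).
Hypotheses (n1_ge : (2 * a + 1 <= n1)%N) (n2_ge : (2 * a + 1 <= n2)%N).

Definition side (s : bool) : int := if s then n2%:Z else 1.
(** [s = true] goes with layer steps of length [a], [s = false] with those of length [b]; [shift s]
    is the other number, so that a corner and its mate in the next layer are one move apart. *)
Definition shift (s : bool) : nat := if s then b else a.
Definition corner s : cell := [:: 1; side s].
Definition mate s : cell := [:: 1 + (shift s)%:Z; side s].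
Definition special : seq cell := [:: corner true; corner false; mate true; mate false].

Lemma cell2 c : on_board [:: n1; n2] c -> exists x y, c = [:: x; y].
Proof. by move=> /on_board2P[x [y [w [-> _ _ /size_on_board/size0nil ->]]]]; exists x, y. Qed.

(** A move changes the second coordinate by [a] or [b], whereas the outer rows 1 and [n2] are at
    least [2 * a] apart. *)
Lemma adj_rows p q s s' : adj a b [:: n1; n2] p q ->
  nth 0 p 1 = side s -> nth 0 q 1 = side s' -> False.
Proof.
move=> pq; have := pq; case/adjP => /cell2[x [y Ep]] /cell2[x' [y' Eq]] _; subst.
by case: (adj2P pq) => _ _ _ _ /= H Ey Ey'; move: H; rewrite Ey Ey' /side; case: s s' {Ey Ey'} => -[]; lia.
Qed.

Lemma specialP p : p \in special -> exists s, p = corner s \/ p = mate s.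
Proof.
by rewrite !inE => /or4P[] /eqP ->; [exists true|exists false|exists true|exists false]; auto.
Qed.

Lemma corner_special s : corner s \in special.
Proof. by case: s; rewrite !inE eqxx ?orbT. Qed.

Lemma mate_special s : mate s \in special.
Proof. by case: s; rewrite !inE eqxx ?orbT. Qed.

Lemma special_row p : p \in special -> exists s, nth 0 p 1 = side s.
Proof. by move=> /specialP[s [] ->]; exists s. Qed.

Lemma on_board_special p : p \in special -> on_board [:: n1; n2] p.
Proof.
by move=> /specialP[[] [] ->]; rewrite !on_board_cons on_board_nil /side /shift; lia.
Qed.

(** The half turn exchanges the rows 1 and [n2]. It fixes the column [1 + a] if [n1 = 2 * a + 1],
    but just one special cell lies there; the others land to the right of all special cells. *)
Lemma flip_special p : p \in special -> flip n1 n2 p \notin special.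
Proof.
move=> /specialP[s sp]; apply/negP => /specialP[s' sp'].
suff: False by []; move: sp'.
by case: sp => ->; case: s s' => -[] [] /= [] ; rewrite /side /shift /=; lia.
Qed.

Lemma flip_special_row p : p \in special -> exists s, nth 0 (flip n1 n2 p) 1 = side s.
Proof.
by move=> /specialP[s sp]; exists (~~ s); case: sp => ->; case: s; rewrite /= /side /=; lia.
Qed.

Definition inward (s : bool) : int := if s then -1 else 1.

Lemma corner_neighbour s (x y : int) :
  `|x - 1| = a%:Z /\ `|y - side s| = b%:Z \/ `|x - 1| = b%:Z /\ `|y - side s| = a%:Z ->
  1 <= x <= n1%:Z -> 1 <= y <= n2%:Z ->
  (x = 1 + a%:Z /\ y = side s + inward s * b%:Z) \/
  (x = 1 + b%:Z /\ y = side s + inward s * a%:Z).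
Proof. by rewrite /side /inward; case: s; lia. Qed.

(* In the third case no edge of the corner ends at distance [shift s] from the
   neighbour; only one neighbour of the mate is of this kind. *)
Lemma mate_neighbour s (x y : int) :
  `|x - (1 + (shift s)%:Z)| = a%:Z /\ `|y - side s| = b%:Z \/
    `|x - (1 + (shift s)%:Z)| = b%:Z /\ `|y - side s| = a%:Z ->
  1 <= x <= n1%:Z -> 1 <= y <= n2%:Z ->
  [\/ `|x - (1 + a%:Z)| = (shift s)%:Z /\ y = side s + inward s * b%:Z,
      `|x - (1 + b%:Z)| = (shift s)%:Z /\ y = side s + inward s * a%:Z
    | x = 1 + a%:Z - b%:Z /\ y = side s + inward s * a%:Z].
Proof.
move=> mv bx bdy.
have [yE|yE] : (`|y - side s| = b%:Z /\ y = side s + inward s * b%:Z) \/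
    (`|y - side s| = a%:Z /\ y = side s + inward s * a%:Z).
- by case: mv => -[_ dy]; [left|right]; split=> //; move: dy bdy;
    rewrite /side /inward; case: s; lia.
- constructor 1; case: yE => dy yE; split=> //; clear bdy yE.
  by move: mv dy; rewrite /shift; case: s; lia.
case: yE => dy yE; clear bdy; rewrite yE; clear yE.
move: mv; rewrite dy /shift; case: s {dy} => mv; first by constructor 2; lia.
have [E|E] : x = 1 + a%:Z + b%:Z \/ x = 1 + a%:Z - b%:Z by lia.
- by constructor 2; lia.
- by constructor 3.
Qed.

(** These are the edges to be exchanged: placed in layers whose distance is the other of [a] and
    [b], their ends match up by moves along the first and third axes. *)
Lemma join_edges c s : is_tour a b [:: n1; n2] c ->
  exists x x' y, [/\ cedge c (corner s) [:: x; y], cedge c (mate s) [:: x'; y]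
                   & `|x' - x| = (shift s)%:Z].
Proof.
move=> tc; have [Uc c3 mem_c ec] := tc.
have cc : corner s \in c by rewrite mem_c on_board_special ?corner_special.
have cm : mate s \in c by rewrite mem_c on_board_special ?mate_special.
have [q1 [q2 [nq12 cq1 cq2 aq1 aq2]]] :=
  cycle_two_neighbours (@adj_sym a b _) Uc c3 ec cc.
have [r1 [r2 [nr12 cr1 cr2 ar1 ar2]]] :=
  cycle_two_neighbours (@adj_sym a b _) Uc c3 ec cm.
have cell_of u v : cedge c u v -> exists x y, v = [:: x; y].
  by case/and3P=> _ cv _; apply: cell2; rewrite -mem_c.
have [x1 [y1 E1]] := cell_of _ _ cq1.
have [x2 [y2 E2]] := cell_of _ _ cq2.
have [u1 [v1 F1]] := cell_of _ _ cr1.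
have [u2 [v2 F2]] := cell_of _ _ cr2.
subst.
have neq2 (x y x' y' : int) : [:: x; y] != [:: x'; y'] -> x <> x' \/ y <> y'.
  by rewrite eqseq_cons eqseq_cons andbT negb_and => /orP[]/eqP; [left|right].
have {}nq12 := neq2 _ _ _ _ nq12; have {}nr12 := neq2 _ _ _ _ nr12.
have [_ _ B1 B2 M1] := adj2P aq1; have [_ _ B3 B4 M2] := adj2P aq2.
have [_ _ B5 B6 M3] := adj2P ar1; have [_ _ B7 B8 M4] := adj2P ar2.
have {}M1 := corner_neighbour M1 B1 B2; have {}M2 := corner_neighbour M2 B3 B4.
have {}M3 := mate_neighbour M3 B5 B6; have {}M4 := mate_neighbour M4 B7 B8.
(* The corner has only two candidate neighbours, so both are used, in one order or the other. *)
have [xa [ya [xb [yb [ca cb [Exa Eya Exb Eyb]]]]]] : exists xa ya xb yb,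
   [/\ cedge c (corner s) [:: xa; ya], cedge c (corner s) [:: xb; yb] &
    [/\ xa = 1 + a%:Z, ya = side s + inward s * b%:Z, xb = 1 + b%:Z & yb = side s + inward s * a%:Z]].
  case: M1 M2 => -[? ?] [] [? ?]; subst; try by case: nq12.
  - by do 4!eexists; split; [exact: cq1|exact: cq2|].
  - by do 4!eexists; split; [exact: cq2|exact: cq1|].
subst xa ya xb yb.
have fin u v : cedge c (mate s) [:: u; v] ->
   (`|u - (1 + a%:Z)| = (shift s)%:Z /\ v = side s + inward s * b%:Z) \/
   (`|u - (1 + b%:Z)| = (shift s)%:Z /\ v = side s + inward s * a%:Z) ->
   exists x x' y, [/\ cedge c (corner s) [:: x; y], cedge c (mate s) [:: x'; y]
                   & `|x' - x| = (shift s)%:Z].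
  by move=> cuv [] [E Ev]; subst v; [exists (1 + a%:Z), u, (side s + inward s * b%:Z)
    |exists (1 + b%:Z), u, (side s + inward s * a%:Z)].
(* The exceptional third case pins down one cell, so the two distinct neighbours of the mate cannot
   both fall in it. *)
case: M3 => M3; [by apply: fin cr1 _; left|by apply: fin cr1 _; right|].
case: M4 => M4; [by apply: fin cr2 _; left|by apply: fin cr2 _; right|].
by exfalso; clear -M3 M4 nr12; lia.
Qed.

End Corners.

(** * Reaching every layer by steps [+a] and [-b] *)

Lemma layers_reachable (a b m : nat) (P : nat -> Prop) :
  (0 < b)%N -> (b < a)%N -> coprime a b -> (a + b - 1 <= m)%N ->
  P a ->
  (forall z, P z -> (z + a <= m)%N -> P (z + a)%N) ->
  (forall z, P (z + b)%N -> (0 < z <= m)%N -> P z) ->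
  forall z, (0 < z <= m)%N -> P z.
Proof.
move=> b_gt0 ltba co_ab m_ge Pa Padd Psub.
pose N := (a + b)%N.
have co_aN : coprime a N by rewrite /N /coprime gcdnDl.
have modN_gt0 j : (0 < j < N)%N -> (0 < (j * a) %% N)%N.
  move=> /andP[j_gt0 ltjN]; rewrite lt0n; apply/negP => /eqP/eqP.
  rewrite -/(dvdn _ _) Gauss_dvdl 1?coprime_sym // => /(dvdn_leq j_gt0); lia.
have Porbit j : (0 < j < N)%N -> P ((j * a) %% N)%N.
  elim: j => // j IHj lt_j; have [->|j_gt0] := posnP j.
    by rewrite mul1n modn_small // /N; lia.
  have ltj : (0 < j < N)%N by lia.
  have := modN_gt0 _ lt_j; have := modN_gt0 _ ltj; have {IHj} := IHj ltj.
  rewrite mulSnr -modnDml.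
  have : ((j * a) %% N < N)%N by rewrite ltn_mod /N; lia.
  move: ((j * a) %% N)%N => r ltrN Pr r_gt0.
  (* Both steps add [a] modulo [N]; exactly one of them stays between 0 and [N - 1]. *)
  have [lt|ge] := ltnP (r + a) N.
    by rewrite modn_small // => _; apply: Padd => //; lia.
  have Era : (r + a)%N = ((r - b) + N)%N by rewrite /N in ge *; lia.
  rewrite Era modnDr modn_small; last by lia.
  move=> rb_gt0; apply: Psub; last by rewrite /N in ltrN; lia.
  by rewrite subnK //; lia.
have Psmall z : (0 < z < N)%N -> P z.
  move=> /andP[z_gt0 ltzN].
  (* [u] inverts [a] modulo [N], so [z] is the orbit point of index [z * u]. *)
  case: (@egcdnP a N) => [|u v Euv _]; first by lia.
  have Ez : ((z * u %% N) * a %% N)%N = z.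
    rewrite modnMml -mulnA Euv (eqP co_aN) mulnDr muln1 mulnA modnMDl.
    exact: modn_small.
  have := Porbit ((z * u) %% N)%N; rewrite Ez; apply; rewrite ltn_mod; apply/andP; split; last by lia.
  by rewrite lt0n; apply: contraTneq z_gt0 => E0; rewrite -Ez E0 mul0n mod0n.
(* A layer [z >= N] comes from [z - a], which is still positive. *)
elim/ltn_ind => z IHz lez; have [|geN] := ltnP z N; first by move=> ?; apply: Psmall; lia.
rewrite -(@subnK a z); last by rewrite /N in geN; lia.
apply: Padd; last by rewrite /N in geN; lia.
by apply: IHz; rewrite /N in geN; lia.
Qed.

(** * Splicing the layers of one stack *)

Lemma ins2 z x y w : ins z [:: x, y & w] = [:: x, y, z%:Z & w].
Proof. by rewrite /ins /= take0 drop0. Qed.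

Lemma ins_injective z : injective (ins z).
Proof.
move=> [|x [|y w]] [|x' [|y' w']]; rewrite ?ins2 /ins //=.
  by case=> ->.
by case=> -> -> ->.
Qed.

(** With this, [join_edges], proved for the planar tour [C], supplies edges of [H] over [w]. *)
Definition intact (a b n2 : nat) (C H : seq cell) (w : cell) : Prop :=
  forall p q, p \in special a b n2 -> cedge C p q -> cedge H (p ++ w) (q ++ w).

(** [z] is a layer already joined, [z'] the next one. Each kind of step determines [z'] from [z], so
    corner [s] of a layer is spent at most once. Adding [b] to [z'] avoids truncated subtraction. *)
Definition link (a b : nat) (s : bool) (z z' : nat) : bool :=
  if s then z' == (z + a)%N else z == (z' + b)%N.

Lemma link_inj a b s z z1 z2 : link a b s z z1 -> link a b s z z2 -> z1 = z2.
Proof. by rewrite /link; case: s => /eqP; lia. Qed.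

Lemma link_dist a b s (z z' : nat) : link a b s z z' ->
  `|z'%:Z - z%:Z| = (if s then a else b)%:Z.
Proof. by rewrite /link; case: s => /eqP; lia. Qed.

Section Extend.
Variables (a b n1 n2 m : nat) (ns : seq nat) (C H : seq cell) (w : cell).
Hypotheses (b_gt0 : (0 < b)%N) (ltba : (b < a)%N).
Hypotheses (n1_ge : (2 * a + 1 <= n1)%N) (n2_ge : (2 * a + 1 <= n2)%N).
Hypothesis m_ge : (a + b - 1 <= m)%N.
Hypothesis tour_C : is_tour a b [:: n1; n2] C.
Hypothesis tour_H : is_tour a b [:: n1, n2 & ns] H.
Hypothesis intact_CH : intact a b n2 C H w.

Let adjm := adj a b [:: n1, n2, m & ns].
Let cor := corner n2.
Let mat := mate a b n2.
Let touched := [seq p ++ w | p <- special a b n2].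

(* The edges at a corner are only kept for steps that have not been made yet; as
   each step makes its target a member of [zs], no other bookkeeping is needed. *)
Definition joined (zs : seq nat) (D : seq cell) : Prop :=
  [/\ uniq zs, {in zs, forall z, (0 < z <= m)%N},
      perm_eq D [seq ins z h | z <- zs, h <- H], cycle adjm D
    & (forall z h k, z \in zs -> cedge H h k -> h \notin touched -> k \notin touched ->
         cedge D (ins z h) (ins z k))
   /\ (forall s z q, z \in zs -> (forall z', link a b s z z' -> z' \notin zs) ->
         cedge C (cor s) q -> cedge D (ins z (cor s ++ w)) (ins z (q ++ w)))].

Let size_H h : h \in H -> (2 <= size h)%N.
Proof. by case: tour_H => _ _ -> _ /size_on_board ->. Qed.

Let layers_uniq zs : uniq zs -> uniq [seq ins z h | z <- zs, h <- H].
Proof.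
case: tour_H => UH _ _ _ Uzs; apply: allpairs_uniq => // -[z h] [z' h'].
move=> /allpairsP[[z1 h1] [_ /= h1H [-> ->]]] /allpairsP[[z2 h2] [_ /= h2H [-> ->]]] /= E.
by have [-> ->] := ins_inj (size_H h1H) (size_H h2H) E.
Qed.

Let cedge_C (p q : cell) : cedge C p q -> exists x y, q = [:: x; y].
Proof. by case: tour_C => _ _ mem_C _ /and3P[_ cq _]; apply: (@cell2 n1 n2); rewrite -mem_C. Qed.

Let cedge_rows (p q : cell) s s' : cedge C p q -> nth 0 p 1 = side n2 s -> nth 0 q 1 = side n2 s' -> False.
Proof. by move=> /(tour_adj tour_C) pq Ep Eq; exact (adj_rows b_gt0 ltba n1_ge n2_ge pq Ep Eq). Qed.

Let corner_touched s : cor s ++ w \in touched.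
Proof. by exact: (map_f (cat^~ w) (corner_special a b n2 s)). Qed.

Let mate_touched s : mat s ++ w \in touched.
Proof. by exact: (map_f (cat^~ w) (mate_special a b n2 s)). Qed.

(** The splice can destroy edges only at corner [s] of layer [z] and at mate [s] of layer [z']; both
    corners of the new layer thus remain usable. *)
Lemma attach zs D s z z' : joined zs D -> z \in zs -> z' \notin zs ->
  (0 < z' <= m)%N -> link a b s z z' -> exists D', joined (z' :: zs) D'.
Proof.
move=> [Uzs zs_m permD eD [keepD cornerD]] zs_z zs_z' z'_m lnk.
have [UH _ mem_H eH] := tour_H.
have [x [x' [y [Cpq Cpq' dx]]]] := join_edges b_gt0 ltba n1_ge n2_ge s tour_C.
have Hpq := intact_CH (corner_special a b n2 s) Cpq.
have Hpq' := intact_CH (mate_special a b n2 s) Cpq'.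
(* [z'] is the only target of this kind from [z] and is not joined yet, so the corner edge is still
   available. *)
have Dpq : cedge D (ins z (cor s ++ w)) (ins z ([:: x; y] ++ w)).
  by apply: cornerD => // z'' lnk'; rewrite -(link_inj lnk lnk').
have H'pq : cedge (map (ins z') H) (ins z' (mat s ++ w)) (ins z' ([:: x'; y] ++ w)).
  by rewrite cedge_map //; exact: ins_injective.
have on_m t h : cedge H h t -> on_board [:: n1, n2 & ns] h by case/and3P; rewrite mem_H.
have ins_m t h : (0 < t <= m)%N -> on_board [:: n1, n2 & ns] h ->
    on_board [:: n1, n2, m & ns] (ins t h).
  by move=> ht bh; apply/on_board_insP; exists t, h.
have dz := link_dist lnk.
have shiftE : (shift a b s = a /\ (if s then a else b) = b) \/
              (shift a b s = b /\ (if s then a else b) = a).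
  by rewrite /shift; case: (s); [right|left].
have z_m := zs_m _ zs_z.
have adj_p : adjm (ins z (cor s ++ w)) (ins z' (mat s ++ w)).
  have b1 := ins_m _ _ z_m (on_m _ _ Hpq).
  have b2 := ins_m _ _ z'_m (on_m _ _ Hpq').
  move: b1 b2; rewrite /cor /mat !ins2 => b1 b2.
  by apply: (adj_layers b1 b2 _ dz shiftE); rewrite addrC addKr ger0_norm.
have adj_q : adjm (ins z ([:: x; y] ++ w)) (ins z' ([:: x'; y] ++ w)).
  rewrite cedgeC in Hpq; rewrite cedgeC in Hpq'.
  have b1 := ins_m _ _ z_m (on_m _ _ Hpq).
  have b2 := ins_m _ _ z'_m (on_m _ _ Hpq').
  move: b1 b2; rewrite !ins2 => b1 b2.
  exact: (adj_layers b1 b2 dx dz shiftE).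
have permD' : perm_eq (D ++ map (ins z') H) [seq ins z h | z <- z' :: zs, h <- H].
  by rewrite perm_catC /= perm_cat2l.
have Uz' : uniq (z' :: zs) by rewrite /= zs_z'.
have UD' : uniq (D ++ map (ins z') H) by rewrite (perm_uniq permD') layers_uniq.
have eH' : cycle adjm (map (ins z') H).
  by rewrite cycle_map; apply: sub_cycle eH => h k; exact: adj_ins.
have [D' [permDD' eD' keep1 keep2]] :=
  merge_cycles (@adj_sym a b _) UD' eD eH' Dpq H'pq adj_p adj_q.
exists D'; split=> //.
- by move=> t; rewrite inE => /predU1P[->|/zs_m].
- exact: perm_trans permDD' permD'.
split.
- have neq t t' h s' f : h \in H -> h \notin touched -> f \in [:: cor s'; mat s'] ->
      ins t h != ins t' (f ++ w).
    move=> Hh th; rewrite !inE => fE; apply/eqP => E; move: th.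
    have sz_f : (2 <= size (f ++ w))%N by case/orP: fE => /eqP ->.
    have [_ ->] := ins_inj (size_H Hh) sz_f E.
    by case/orP: fE => /eqP ->; rewrite ?corner_touched ?mate_touched.
  move=> t h k; rewrite inE => /predU1P[->|zs_t] Hhk th tk;
    have /and3P[Hh Hk _] := Hhk.
    apply: keep2; first by rewrite cedge_map //; exact: ins_injective.
    + by apply: (neq _ _ _ s); rewrite // !inE eqxx orbT.
    + by apply: (neq _ _ _ s); rewrite // !inE eqxx orbT.
  apply: keep1; first exact: keepD.
  + by apply: (neq _ _ _ s); rewrite // !inE eqxx.
  + by apply: (neq _ _ _ s); rewrite // !inE eqxx.
move=> t' t q; rewrite inE => /predU1P[->|zs_t] free Cq;
  have [xq [yq Eq]] := cedge_C Cq; subst q.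
- apply: keep2.
  + rewrite cedge_map //; last exact: ins_injective.
    by apply: intact_CH => //; exact: corner_special.
  + rewrite !ins2; apply/eqP => -[]; rewrite /shift; case: (s) => /=; clear -b_gt0 ltba; lia.
  (* A neighbour of a corner lies off the outer rows, so it is not the mate. *)
  + rewrite !ins2; apply/eqP => -[_ Ey].
    exact: (cedge_rows (s := t') (s' := s) Cq).
apply: keep1.
- apply: cornerD => // z'' lnk''; apply: contra (free z'' lnk'').
  by rewrite inE orbC => ->.
(* Only corner [s] of layer [z] is spoiled, and the target of its step has just been joined. *)
- rewrite !ins2; apply/eqP => -[Erow Et].
  have Es : t' = s by move: Erow; rewrite /side; case: (t') (s) => -[]; clear -n2_ge ltba; lia.
  by subst; have := free _ lnk; rewrite mem_head.
- rewrite !ins2; apply/eqP => -[_ Ey _].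
  exact: (cedge_rows (s := t') (s' := s) Cq).
Qed.

Lemma joined_root : joined [:: a] (map (ins a) H).
Proof.
have [UH _ _ eH] := tour_H.
have a_m : (0 < a <= m)%N by lia.
split=> //; first by move=> z; rewrite inE => /eqP ->.
- by rewrite /= cats0.
- by rewrite cycle_map; apply: sub_cycle eH => h k; exact: adj_ins.
split=> [z h k|s z q]; rewrite inE => /eqP ->.
  by rewrite cedge_map //; exact: ins_injective.
move=> _ Cq; rewrite cedge_map //; last exact: ins_injective.
by apply: intact_CH => //; exact: corner_special.
Qed.

(** If no step leaves [zs], then [zs] contains [a] and is closed under both steps, so
    [layers_reachable] makes it everything. *)
Lemma joined_grow zs D : joined zs D -> a \in zs ->
  (forall z, (0 < z <= m)%N -> z \in zs) \/ exists z D', joined (z :: zs) D'.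
Proof.
move=> J zs_a.
have co_ab : coprime a b by apply: tour_coprime tour_C; lia.
pose ready z z' := (link a b true z z' || link a b false z z') && (z' \notin zs).
have [/hasP[z zs_z /hasP[z']]|/hasPn closed] :=
    boolP (has (fun z => has (ready z) (iota 1 m)) zs).
  rewrite mem_iota => z'_m /andP[lnk zs_z']; right; exists z'.
  have {}z'_m : (0 < z' <= m)%N by lia.
  by case/orP: lnk; exact: attach J zs_z zs_z' z'_m.
left=> z; apply: (layers_reachable (P := fun z => z \in zs) _ _ co_ab m_ge) => // {}z zs_z z_m;
  have /hasPn := closed _ zs_z.
- by move=> /(_ (z + a)%N); rewrite mem_iota /ready /link eqxx /= negbK; apply; lia.
- by move=> /(_ z); rewrite mem_iota /ready /link eqxx orbT /= negbK; apply; lia.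
Qed.

Lemma joined_all : exists zs D, joined zs D /\ forall z, (0 < z <= m)%N -> z \in zs.
Proof.
(* The induction is on a bound [d] that exceeds the number of layers still missing. *)
suff grow d : forall zs D, joined zs D -> a \in zs -> (m < size zs + d)%N ->
    exists zs' D', joined zs' D' /\ forall z, (0 < z <= m)%N -> z \in zs'.
  by apply: (grow m _ _ joined_root); rewrite ?mem_head //= add1n.
elim: d => [|d IHd] zs D J zs_a lt_m.
  have [Uzs zs_m _ _ _] := J.
  suff : (size zs <= size (iota 1 m))%N by rewrite size_iota; lia.
  by apply: uniq_leq_size => // t /zs_m; rewrite mem_iota; lia.
have [zs_all|[z [D' J']]] := joined_grow J zs_a; first by exists zs, D.
by apply: (IHd _ _ J'); rewrite ?inE ?zs_a ?orbT //= addSnnS.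
Qed.

(** The edge clause drives the induction on the dimension: all splices happen over the fibre [w], so
    edges avoiding its special cells are copied in every layer. *)
Lemma extend_tour : exists D, is_tour a b [:: n1, n2, m & ns] D /\
  forall z h k, (0 < z <= m)%N -> cedge H h k -> h \notin touched -> k \notin touched ->
    cedge D (ins z h) (ins z k).
Proof.
have [zs [D [[Uzs zs_m permD eD [keepD _]] zs_all]]] := joined_all.
have [UH H3 mem_H _] := tour_H.
have mem_D x : (x \in D) = on_board [:: n1, n2, m & ns] x.
  rewrite (perm_mem permD); apply/allpairsP/on_board_insP.
    by case=> -[z h] [/= /zs_m hz hH ->]; exists z, h; rewrite -mem_H.
  by case=> z [h [-> hz bh]]; exists (z, h); rewrite /= zs_all // mem_H.
exists D; split; last by move=> z h k hz; apply: keepD; exact: zs_all.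
split=> //; first by rewrite (perm_uniq permD) layers_uniq.
rewrite (perm_size permD) size_allpairs (leq_trans H3) //.
rewrite leq_pmull // lt0n size_eq0; apply: contraTneq (zs_all a _) => [->|] //.
by lia.
Qed.

End Extend.

(** * Induction on the dimension *)

(** One fibre is spent on the next stack while the other is copied to each layer, which yields two
    again. [C] is quantified too, since the first stack replaces it by its half turn. *)
Definition has_two_intact (a b n1 n2 : nat) (ns : seq nat) : Prop :=
  exists C H w1 w2, [/\ is_tour a b [:: n1; n2] C, is_tour a b [:: n1, n2 & ns] H,
    w1 != w2, intact a b n2 C H w1 & intact a b n2 C H w2].

Section Induction.
Variables (a b n1 n2 m : nat).
Hypotheses (b_gt0 : (0 < b)%N) (ltba : (b < a)%N).
Hypotheses (n1_ge : (2 * a + 1 <= n1)%N) (n2_ge : (2 * a + 1 <= n2)%N).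
Hypothesis m_ge : (a + b - 1 <= m)%N.

(** Stacking [C] itself, with the empty fibre, damages edges only at [special] cells. The half turn
    moves this damage to the opposite side, so every [[:: z]] becomes an intact fibre. *)
Lemma two_intact_base : tour_exists a b [:: n1; n2] ->
  has_two_intact a b n1 n2 [:: m].
Proof.
move=> [C tour_C]; have [UC _ mem_C _] := tour_C.
have intact_C : intact a b n2 C C [::] by move=> p q _; rewrite !cats0.
have [D [tour_D keep]] := extend_tour b_gt0 ltba n1_ge n2_ge m_ge tour_C tour_C intact_C.
have inj_f := can_inj (flipK n1 n2).
have [UD _ _ _] := tour_D.
suff intact_z (z : nat) : (0 < z <= m)%N ->
    intact a b n2 (map (flip n1 n2) C) (map (flip n1 n2) D) [:: z%:Z].
  (* Layers 1 and 2 exist, as [m >= a + b - 1 >= 2]. *)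
  exists (map (flip n1 n2) C), (map (flip n1 n2) D), [:: 1%N%:Z], [:: 2%N%:Z].
  by split=> //; [exact: tour_flip|exact: tour_flip|apply: intact_z; lia..].
move=> z_m p q sp; rewrite -{1}[p](flipK n1 n2) -{1}[q](flipK n1 n2) cedge_map // => Cpq.
have := keep z _ _ z_m Cpq; under eq_map do rewrite cats0; rewrite map_id.
have row_p := flip_special_row b_gt0 ltba n1_ge n2_ge sp.
(* A neighbour of a cell in an outer row lies off both outer rows, hence is not special. *)
have sq : flip n1 n2 q \notin special a b n2.
  apply/negP => /special_row[s' row_q]; have [s {}row_p] := row_p.
  exact: (adj_rows b_gt0 ltba n1_ge n2_ge (tour_adj tour_C Cpq) row_p row_q).
move=> /(_ (flip_special b_gt0 ltba n1_ge n2_ge sp) sq).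
have [x [y Ep]] : exists x y, p = [:: x; y].
  by apply: (@cell2 n1 n2); exact: on_board_special sp.
have [x' [y' Eq]] : exists x y, q = [:: x; y].
  by apply: (@cell2 n1 n2); case/and3P: Cpq => _; rewrite mem_C on_board_flip.
subst; rewrite -(cedge_map _ _ inj_f UD) !ins2 /= -!/(flip n1 n2 _).
by congr cedge; congr [:: _, _ & _]; lia.
Qed.

Lemma two_intact_step ns : has_two_intact a b n1 n2 ns ->
  has_two_intact a b n1 n2 (m :: ns).
Proof.
move=> [C [H [w1 [w2 [tour_C tour_H w12 int1 int2]]]]].
have [D [tour_D keep]] := extend_tour b_gt0 ltba n1_ge n2_ge m_ge tour_C tour_H int1.
have [_ _ mem_C _] := tour_C.
suff intact_z (z : nat) : (0 < z <= m)%N -> intact a b n2 C D (z%:Z :: w2).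
  exists C, D, (1%N%:Z :: w2), (2%N%:Z :: w2).
  by split=> //; apply: intact_z; lia.
have cell_of p : p \in C -> exists x y, p = [:: x; y].
  by rewrite mem_C; exact: cell2.
(* Special cells have exactly two coordinates, so a touched cell lying over [w2] would force
   [w1 = w2]. *)
have untouched p : p \in C -> p ++ w2 \notin [seq p ++ w1 | p <- special a b n2].
  move=> /cell_of[x [y ->]]; apply/mapP => -[p' sp'].
  have [x' [y' ->]] : exists x y, p' = [:: x; y].
    by apply: (@cell2 n1 n2); exact: on_board_special sp'.
  by case=> _ _ E; rewrite E eqxx in w12.
move=> z_m p q sp Cpq; have /and3P[Cp Cq _] := Cpq.
have := keep z _ _ z_m (int2 _ _ sp Cpq) (untouched _ Cp) (untouched _ Cq).
by have [x [y ->]] := cell_of _ Cp; have [x' [y' ->]] := cell_of _ Cq; rewrite !ins2.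
Qed.

End Induction.

(* ns = [:: n_3; ...; n_k], so k = size ns + 2 >= 2. *)
Theorem theorem5p5 (alpha beta n1 n2 : nat) (ns : seq nat) :
  (0 < beta)%N -> (beta < alpha)%N ->
  (2 * alpha + 1 <= n1)%N -> (2 * alpha + 1 <= n2)%N ->
  all (fun m => (alpha + beta - 1 <= m)%N) ns ->
  tour_exists alpha beta [:: n1; n2] ->
  tour_exists alpha beta (n1 :: n2 :: ns).
Proof.
move=> b_gt0 ltba n1_ge n2_ge ns_ge tour_C.
case: ns ns_ge => [//|m ns] ns_ge.
suff [C [H [w1 [w2 [_ tour_H _ _ _]]]]] : has_two_intact alpha beta n1 n2 (m :: ns).
  by exists H.
(* The stacks are built from the last dimension back to the third: [ins] puts each new coordinate in
   front of those already added. *)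
elim: ns m ns_ge => [|m' ns IHns] m /andP[m_ge ns_ge].
  exact: two_intact_base.
by apply: two_intact_step => //; exact: IHns.
Qed.
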